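(* Let $L>0$, let $H^*_L\in\mathbb{R}$ be a given set point, and let $D(t)$, $t\in[0,+\infty)$, be the disturbance input. Consider the physical system, with state $(H,Q):[0,+\infty)\times[0,L]\to\mathbb{R}^2$, $$H_t+Q_x=0,\qquad Q_t+(f(H,Q))_x+g(H,Q)=0,$$ $$\alpha(H(t,0),Q(t,0))=D(t),\qquad \beta(H(t,L),Q(t,L))=U(t),$$ and the controller system, with state $(\widehat H,\widehat Q):[0,+\infty)\times[0,L]\to\mathbb{R}^2$, $$\widehat H_t+\widehat Q_x=0,\qquad \widehat Q_t+(f(\widehat H,\widehat Q))_x+g(\widehat H,\widehat Q)=0,$$ $$\alpha(\widehat H(t,0),\widehat Q(t,0))=D(t),\qquad \widehat H(t,L)=H^*_L.$$ Assume that the two systems are interconnected with the control law $$U(t)=\beta(H^*_L,\widehat Q(t,L)),$$ and that they have the same initial condition $$H(0,x)=\widehat H(0,x),\quad Q(0,x)=\widehat Q(0,x)\quad\text{for all }x\in[0,L],$$ with $H(0,L)=\widehat H(0,L)=H^*_L$. Then, for all positive $t$, it holds that $H(t,L)=H^*_L$.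
   Context: The functions $f,g,\alpha,\beta:\mathbb{R}^2\to\mathbb{R}$ are sufficiently smooth. Subscripts $t$ and $x$ denote partial derivatives. $D(t)$ is a bounded measurable function of time and $U(t)$ is the control input. Standing assumption: the physical system is well posed in the domain of interest, i.e. for the given initial condition $(H(0,\cdot),Q(0,\cdot))$ and the given inputs $D(t)$, $U(t)$, it has a unique solution $(H,Q)$ on $[0,+\infty)\times[0,L]$ (in the class of solutions under consideration, to which the solution $(\widehat H,\widehat Q)$ of the controller system also belongs). *)

(* Defs.v *)
From HB Require Import structures.
From mathcomp Require Import all_boot all_order all_algebra.
From mathcomp Require Import all_classical all_reals all_analysis.

Set Implicit Arguments.
Unset Strict Implicit.
Unset Printing Implicit Defensive.

Import Order.TTheory GRing.Theory Num.Theory.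
Import numFieldNormedType.Exports.

Local Open Scope classical_set_scope.
Local Open Scope ring_scope.

(* Functions of (t, x), as well as the functions f, g, alpha, beta of (H, Q),
   have type R * R -> R.  The states are total functions of which only the
   values on [0, +oo[ x [0, L] matter. *)

Definition dom (R : realType) (L : R) : set (R * R) :=
  [set z | 0 <= z.1 /\ 0 <= z.2 <= L].

Definition C1 (R : realType) (u : R * R -> R) : Prop :=
  (forall z, differentiable u z) /\ (forall v, continuous ('D_v u)).

Definition test_function (R : realType) (phi : R * R -> R) : Prop :=
  C1 phi /\ exists M : R, forall z, M < `|z| -> phi z = 0.

Definition bounded_measurable_input (R : realType) (D : R -> R) : Prop :=
  measurable_fun (`[0, +oo[ : set (measurableTypeR R))
    (D : measurableTypeR R -> measurableTypeR R) /\
  exists M : R, forall t, 0 <= t -> `|D t| <= M.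

(* The balance law  u_t + F_x + S = 0  on [0, +oo[ x [0, L]:
   - classical: u and F are continuous up to the boundary and the equation holds
     pointwise in the open domain;
   - weak: the equation is multiplied by a test function and integrated by
     parts.  Test functions do not vanish at t = 0, x = 0, x = L, so that the
     initial values of u and the boundary values of F are tied to the interior
     values.  This sense allows discontinuous boundary inputs. *)
Definition classical_balance_law (R : realType) (L : R) (u F S : R * R -> R) :
    Prop :=
  [/\ {within dom L, continuous u}, {within dom L, continuous F} &
    forall t x, 0 < t -> 0 < x < L ->
      [/\ derivable u (t, x) (1, 0), derivable F (t, x) (0, 1) &
          'D_(1, 0) u (t, x) + 'D_(0, 1) F (t, x) + S (t, x) = 0]].

Definition weak_balance_law (R : realType) (L : R) (u F S : R * R -> R) :
    Prop :=
  let mu := @lebesgue_measure R in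
  let mu2 := (mu \x mu)%E in
  [/\ forall T, 0 < T ->
        [/\ mu2.-integrable (`[0, T] `*` `[0, L]) (EFin \o u),
            mu2.-integrable (`[0, T] `*` `[0, L]) (EFin \o F) &
            mu2.-integrable (`[0, T] `*` `[0, L]) (EFin \o S)],
      mu.-integrable `[0, L] (fun x => (u (0, x))%:E),
      forall T, 0 < T ->
        mu.-integrable `[0, T] (fun t => (F (t, 0))%:E) /\
        mu.-integrable `[0, T] (fun t => (F (t, L))%:E) &
      forall phi, test_function phi ->
        \int[mu2]_(z in dom L)
          (u z * 'D_(1, 0) phi z + F z * 'D_(0, 1) phi z - S z * phi z)
        + \int[mu]_(x in `[0, L]) (u (0, x) * phi (0, x))
        + \int[mu]_(t in `[0, +oo[) (F (t, 0) * phi (t, 0))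
        - \int[mu]_(t in `[0, +oo[) (F (t, L) * phi (t, L)) = 0].

Variant solution_sense := Classical | Weak.

Definition balance_law (s : solution_sense) (R : realType) (L : R)
    (u F S : R * R -> R) : Prop :=
  match s with
  | Classical => classical_balance_law L u F S
  | Weak => weak_balance_law L u F S
  end.

Definition pde (s : solution_sense) (R : realType) (f g : R * R -> R) (L : R)
    (H Q : R * R -> R) : Prop :=
  balance_law s L H Q (fun=> 0) /\
  balance_law s L Q (fun z => f (H z, Q z)) (fun z => g (H z, Q z)).

Definition physical_system (s : solution_sense) (R : realType)
    (f g alpha beta : R * R -> R) (L : R) (D U : R -> R) (H Q : R * R -> R) :
    Prop :=
  [/\ pde s f g L H Q,
      forall t, 0 <= t -> alpha (H (t, 0), Q (t, 0)) = D t &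
      forall t, 0 <= t -> beta (H (t, L), Q (t, L)) = U t].

Definition controller_system (s : solution_sense) (R : realType)
    (f g alpha : R * R -> R) (L HL : R) (D : R -> R) (H Q : R * R -> R) :
    Prop :=
  [/\ pde s f g L H Q,
      forall t, 0 <= t -> alpha (H (t, 0), Q (t, 0)) = D t &
      forall t, 0 <= t -> H (t, L) = HL].

Definition initial_condition (R : realType) (L : R) (H0 Q0 : R -> R)
    (H Q : R * R -> R) : Prop :=
  forall x, 0 <= x <= L -> H (0, x) = H0 x /\ Q (0, x) = Q0 x.

(* Existence and uniqueness for the given data, in the class K of solutions
   under consideration (a regularity class, the solutions satisfying an entropy
   condition, etc.).  Uniqueness is pointwise on the closed domain: for weak
   solutions K also has to fix the representatives, boundary values included. *)
Definition well_posed (s : solution_sense) (R : realType)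
    (K : (R * R -> R) -> (R * R -> R) -> Prop)
    (f g alpha beta : R * R -> R) (L : R) (D U H0 Q0 : R -> R) : Prop :=
  let sol H Q := [/\ K H Q, physical_system s f g alpha beta L D U H Q &
                     initial_condition L H0 Q0 H Q] in
  (exists H Q, sol H Q) /\
  (forall H Q H' Q', sol H Q -> sol H' Q' ->
    forall z, dom L z -> H z = H' z /\ Q z = Q' z).

(* Main.v *)
(* The control law turns the boundary condition Hhat(t, L) = HL of the
   controller into beta(Hhat(t, L), Qhat(t, L)) = U(t), so (Hhat, Qhat) solves
   the physical system with the same data and equals (H, Q) by uniqueness. *)

Require Import Defs.
From HB Require Import structures.
From mathcomp Require Import all_boot all_order all_algebra.
From mathcomp Require Import all_classical all_reals all_analysis.

Set Implicit Arguments.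
Unset Strict Implicit.
Unset Printing Implicit Defensive.

Import Order.TTheory GRing.Theory Num.Theory.
Import numFieldNormedType.Exports.

Local Open Scope classical_set_scope.
Local Open Scope ring_scope.

Theorem theorem1 (R : realType) (s : solution_sense)
    (K : (R * R -> R) -> (R * R -> R) -> Prop)
    (f g alpha beta : R * R -> R)
    (f_smooth : C1 f) (g_smooth : C1 g)
    (alpha_smooth : C1 alpha) (beta_smooth : C1 beta)
    (L : R) (L_gt0 : 0 < L) (HL : R)
    (D : R -> R) (D_input : bounded_measurable_input D)
    (U : R -> R) (H Q Hhat Qhat : R * R -> R)
    (K_physical : K H Q) (K_controller : K Hhat Qhat)
    (physical : physical_system s f g alpha beta L D U H Q)
    (controller : controller_system s f g alpha L HL D Hhat Qhat)
    (control_law : forall t, 0 <= t -> U t = beta (HL, Qhat (t, L)))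
    (same_init : forall x, 0 <= x <= L ->
       H (0, x) = Hhat (0, x) /\ Q (0, x) = Qhat (0, x))
    (init_L : H (0, L) = HL /\ Hhat (0, L) = HL)
    (wp : well_posed s K f g alpha beta L D U
            (fun x => H (0, x)) (fun x => Q (0, x))) :
  forall t, 0 < t -> H (t, L) = HL.
Proof.
  case: wp => _ uniq t t_gt0; case: controller => pde_hat alpha_hat Hhat_L.
  (* Uniqueness is pointwise on the closed domain, so it can be evaluated at the boundary point
     [x = L]. *)
  have Lin : dom L (t, L) by split; rewrite /= ?lexx ?andbT ltW.
  have [-> _] : H (t, L) = Hhat (t, L) /\ Q (t, L) = Qhat (t, L).
    (* The initial data in [wp] are those of [(H, Q)] itself, so this pair meets them by
       reflexivity; [(Hhat, Qhat)] remains. *)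
    apply: uniq Lin; first by split.
    split=> //; last by move=> x /same_init[-> ->].
    (* Only the condition at [x = L] is left: both sides become [beta (HL, Qhat (u, L))]. *)
    by split=> // u u_ge0; rewrite Hhat_L// control_law.
  exact/Hhat_L/ltW.
Qed.
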